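(* Let $n\ge 3$ and let $(\mathcal{L},[\cdot,\dots,\cdot],\alpha,\epsilon)$ be a centerless perfect multiplicative $n$-Hom-Lie color algebra. Then the map $\delta:\mathcal{D}(\mathcal{L})\to\mathrm{End}(\mathcal{L})$, $\delta(D)=\delta_D$, is a Hom-Lie color algebra homomorphism, that is, $\delta_{[D_1,D_2]}=[\delta_{D_1},\delta_{D_2}]$ for all $D_1,D_2\in\mathcal{D}(\mathcal{L})$.
   Context: Let $\mathbb{K}$ be a field, $G$ an additive abelian group, and $\epsilon:G\times G\to\mathbb{K}\setminus\{0\}$ a skew-symmetric bicharacter: $\epsilon(g,h)\epsilon(h,g)=1$, $\epsilon(g+h,k)=\epsilon(g,k)\epsilon(h,k)$, $\epsilon(g,h+k)=\epsilon(g,h)\epsilon(g,k)$. For a $G$-graded space $V$, $\mathcal{H}(V)$ is the set of homogeneous elements; inside $\epsilon$, a homogeneous element stands for its degree and a sum of homogeneous elements stands for the sum of their degrees. A linear map $f$ is homogeneous of degree $\theta$ if $f(V_g)\subset V_{g+\theta}$ for all $g\in G$, and even if $\theta=0$. An $n$-Hom-Lie color algebra is a $G$-graded space $\mathcal{L}=\bigoplus_{g\in G}\mathcal{L}_g$ with an $n$-linear bracket $[\cdot,\dots,\cdot]$ compatible with the grading, the bicharacter $\epsilon$, and an even linear map $\alpha:\mathcal{L}\to\mathcal{L}$ such that for all homogeneous $x_i,y_j$: (i) $[x_1,\dots,x_i,x_{i+1},\dots,x_n]=-\epsilon(x_i,x_{i+1})[x_1,\dots,x_{i+1},x_i,\dots,x_n]$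 for $1\le i\le n-1$; (ii) $[\alpha(x_1),\dots,\alpha(x_{n-1}),[y_1,\dots,y_n]]=\sum_{i=1}^n\epsilon(X,Y_i)[\alpha(y_1),\dots,\alpha(y_{i-1}),[x_1,\dots,x_{n-1},y_i],\alpha(y_{i+1}),\dots,\alpha(y_n)]$, with $X=x_1+\dots+x_{n-1}$, $Y_i=y_1+\dots+y_{i-1}$. It is multiplicative if $\alpha([x_1,\dots,x_n])=[\alpha(x_1),\dots,\alpha(x_n)]$. The derived algebra $\mathcal{L}^1=[\mathcal{L},\dots,\mathcal{L}]$ is the subalgebra generated by all brackets $[x_1,\dots,x_n]$; $\mathcal{L}$ is perfect if $\mathcal{L}^1=\mathcal{L}$. The center is $Z(\mathcal{L})=\{x\in\mathcal{L}:[x,\mathcal{L},\dots,\mathcal{L}]=0\}$; $\mathcal{L}$ is centerless if $Z(\mathcal{L})=0$. For $k\ge 0$, a double $\alpha^k$-derivation of degree $d$ of $\mathcal{L}$ is a linear map $D:\mathcal{L}\to\mathcal{L}$, homogeneous of degree $d\in G$, with $D\circ\alpha=\alpha\circ D$ and, for all homogeneous $x_i,y_j$, $$D([x_1,\dots,x_{n-1},[y_1,\dots,y_n]])=\sum_{i=1}^{n-1}\epsilon(d,X_i)[\alpha^k(x_1),\dots,D(x_i),\dots,\alpha^k(x_{n-1}),[\alpha^k(y_1),\dots,\alpha^k(y_n)]]$$ $$+\sum_{j=1}^{n}\epsilon(d,X+Y_j)[\alpha^k(x_1),\dots,\alpha^k(x_{n-1}),[\alpha^k(y_1),\dots,D(y_j),\dots,\alpha^k(y_n)]],$$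 where $X_i=x_1+\dots+x_{i-1}$, $X=x_1+\dots+x_{n-1}$, $Y_j=y_1+\dots+y_{j-1}$. $\mathcal{D}_{\alpha^k}(\mathcal{L})$ is the span of the double $\alpha^k$-derivations, and $\mathcal{D}(\mathcal{L})=\bigoplus_{k\ge0}\mathcal{D}_{\alpha^k}(\mathcal{L})$. The bracket is the color commutator $[D,D']=D\circ D'-\epsilon(d,d')D'\circ D$ for maps of degrees $d,d'$; it sends $\mathcal{D}_{\alpha^k}(\mathcal{L})\times\mathcal{D}_{\alpha^s}(\mathcal{L})$ into $\mathcal{D}_{\alpha^{k+s}}(\mathcal{L})$. For $D\in\mathcal{D}_{\alpha^k}(\mathcal{L})$ of degree $d$, $\delta_D:\mathcal{L}\to\mathcal{L}$ is the (well-defined) linear map given on $x=\sum_{i\in I}[x_{i_1},\dots,x_{i_n}]$ ($I$ finite, $x_{i_t}$ homogeneous) by $\delta_D(x)=\sum_{i\in I}\sum_{t=1}^{n}\epsilon(d,x_{i_1}+\dots+x_{i_{t-1}})[\alpha^k(x_{i_1}),\dots,D(x_{i_t}),\dots,\alpha^k(x_{i_n})]$. The map $\delta$ is defined by this on each component $\mathcal{D}_{\alpha^k}(\mathcal{L})$ (with exponent $k$) and extended linearly; thus for $D_1\in\mathcal{D}_{\alpha^k}(\mathcal{L})$, $D_2\in\mathcal{D}_{\alpha^s}(\mathcal{L})$, $\delta_{[D_1,D_2]}$ is formed with exponent $k+s$.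
   Formalization: The formal statement assumes that δ is well defined on the homogeneous components of D_1 and D_2 (the formula does not depend on the presentation of x as a sum of brackets); this can fail when α is not surjective, so it is not implied by the other hypotheses. *)

(* Defs.v *)
From HB Require Import structures.
From mathcomp Require Import all_boot all_order all_algebra.
From mathcomp Require Import perm all_classical.
Set Implicit Arguments.
Unset Strict Implicit.
Unset Printing Implicit Defensive.
Import GRing.Theory.
Local Open Scope classical_set_scope.
Local Open Scope ring_scope.

Record skew_bicharacter (K : fieldType) (G : zmodType) (eps : G -> G -> K) :
    Prop := SkewBicharacter {
  bichar_neq0 : forall g h, eps g h != 0;
  bichar_skew : forall g h, eps g h * eps h g = 1;
  bicharDl : forall g h k, eps (g + h) k = eps g k * eps h k;
  bicharDr : forall g h k, eps g (h + k) = eps g h * eps g k }.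

Definition is_subspace (K : fieldType) (V : lmodType K) (S : set V) : Prop :=
  S 0 /\ forall (a : K) (u v : V), S u -> S v -> S (a *: u + v).

Definition linear_span (K : fieldType) (V : lmodType K) (S : set V) : set V :=
  smallest (@is_subspace K V) S.

Section Graded.
Variables (K : fieldType) (G : zmodType) (L : lmodType K).
Implicit Types (V : G -> set L) (f : L -> L).

Definition is_decomposition V (x : L) (c : G -> L) : Prop :=
  [/\ forall g, V g (c g), finite_set (c @^-1` [set~ 0])
    & x = \sum_(g \in setT) c g].

(* L is the internal direct sum of the V g *)
Definition is_grading V : Prop :=
  (forall g, is_subspace (V g)) /\
  (forall x, exists! c : G -> L, is_decomposition V x c).

Definition component V (g : G) (x : L) : L :=
  xget (fun=> 0) [set c | is_decomposition V x c] g.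

Definition homogeneous_map V (d : G) f : Prop :=
  forall g x, V g x -> V (g + d) (f x).

Definition map_component V (d : G) f : L -> L :=
  fun x => \sum_(g \in setT) component V (g + d) (f (component V g x)).

(* The bilinear extension of f \o f' - eps d d' *: (f' \o f), for f and f'
   homogeneous of degrees d and d', to finite sums of homogeneous maps. *)
Definition color_commutator (eps : G -> G -> K) V f f' : L -> L :=
  fun x => f (f' x) -
    \sum_(d \in setT) \sum_(d' \in setT)
       eps d d' *: map_component V d' f' (map_component V d f x).

End Graded.

(* (x_1, ..., x_(n-1), z) *)
Definition extend_last (T : Type) (n : nat) (x : 'I_n.-1 -> T) (z : T) :
    'I_n -> T :=
  fun i => if insub (val i) is Some j then x j else z.

(* In [dfwith x i z], the i-th argument of the tuple x is replaced by z. *)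
Record nHomLieColor (K : fieldType) (G : zmodType) (eps : G -> G -> K)
    (n : nat) (L : lmodType K) := NHomLieColor {
  hcomp : G -> set L;
  br : ('I_n -> L) -> L;
  alpha : L -> L;
  hom_grading : is_grading hcomp;
  br_multilinear : forall (x : 'I_n -> L) (i : 'I_n) (a : K) (u v : L),
    br (dfwith x i (a *: u + v)) =
    a *: br (dfwith x i u) + br (dfwith x i v);
  br_graded : forall (g : 'I_n -> G) (x : 'I_n -> L),
    (forall i, hcomp (g i) (x i)) -> hcomp (\sum_i g i) (br x);
  alpha_linear : linear alpha;
  alpha_even : homogeneous_map hcomp 0 alpha;
  br_skew : forall (g : 'I_n -> G) (x : 'I_n -> L),
    (forall i, hcomp (g i) (x i)) ->
    forall i j : 'I_n, j = i.+1 :> nat ->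
    br x = - (eps (g i) (g j) *: br (x \o tperm i j));
  br_jacobi : forall (g : 'I_n.-1 -> G) (x : 'I_n.-1 -> L)
      (h : 'I_n -> G) (y : 'I_n -> L),
    (forall i, hcomp (g i) (x i)) -> (forall j, hcomp (h j) (y j)) ->
    br (extend_last (alpha \o x) (br y)) =
    \sum_(i < n) eps (\sum_j g j) (\sum_(j < n | (j < i)%N) h j) *:
      br (dfwith (alpha \o y) i (br (extend_last x (y i)))) }.

Section Theory.
Variables (K : fieldType) (G : zmodType) (eps : G -> G -> K) (n : nat).
Variables (L : lmodType K) (A : nHomLieColor eps n L).

Local Notation hcomp := (hcomp A).
Local Notation br := (br A).
Local Notation alpha := (alpha A).

Definition multiplicative : Prop :=
  forall x : 'I_n -> L, alpha (br x) = br (alpha \o x).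

Definition is_subalgebra (S : set L) : Prop :=
  [/\ is_subspace S, forall x, S x -> S (alpha x)
    & forall x : 'I_n -> L, (forall i, S (x i)) -> S (br x)].

Definition derived_algebra : set L := smallest is_subalgebra (range br).

Definition perfect : Prop := derived_algebra = setT.

Definition center : set L :=
  [set z | forall x : 'I_n -> L,
     (forall i : 'I_n, i = 0%N :> nat -> x i = z) -> br x = 0].

Definition centerless : Prop := center = [set 0].

Definition double_derivation (k : nat) (d : G) (D : L -> L) : Prop :=
  [/\ linear D, homogeneous_map hcomp d D, D \o alpha = alpha \o D &
    forall (g : 'I_n.-1 -> G) (x : 'I_n.-1 -> L) (h : 'I_n -> G) (y : 'I_n -> L),
    (forall i, hcomp (g i) (x i)) -> (forall j, hcomp (h j) (y j)) ->
    D (br (extend_last x (br y))) =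
      \sum_(i < n.-1) eps d (\sum_(j < n.-1 | (j < i)%N) g j) *:
        br (extend_last (dfwith (iter k alpha \o x) i (D (x i)))
                        (br (iter k alpha \o y)))
      + \sum_(j < n) eps d (\sum_i g i + \sum_(i < n | (i < j)%N) h i) *:
        br (extend_last (iter k alpha \o x)
                        (br (dfwith (iter k alpha \o y) j (D (y j)))))].

Definition double_derivations (k : nat) : set (L -> L) :=
  linear_span [set D | exists d, double_derivation k d D].

(* The direct sum over k is external: the components D k of a single map may
   be double alpha^k-derivations for several k, and delta depends on k. *)
Definition all_double_derivations : set (nat -> L -> L) :=
  [set D | (forall k, double_derivations k (D k)) /\
           finite_set (D @^-1` [set~ 0])].

Definition derivation_bracket (D D' : nat -> L -> L) : nat -> L -> L :=
  fun m x => \sum_(k < m.+1) color_commutator eps hcomp (D k) (D' (m - k)%N) x.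

(* delta_graph k d D x z: some presentation of x as a finite sum of brackets
   of homogeneous elements gives the value z. *)
Definition delta_graph (k : nat) (d : G) (D : L -> L) (x z : L) : Prop :=
  exists (m : nat) (g : 'I_m -> 'I_n -> G) (u : 'I_m -> 'I_n -> L),
  [/\ forall i t, hcomp (g i t) (u i t), x = \sum_(i < m) br (u i) &
    z = \sum_(i < m) \sum_(t < n)
          eps d (\sum_(s < n | (s < t)%N) g i s) *:
          br (dfwith (iter k alpha \o u i) t (D (u i t)))].

Definition delta_homogeneous (k : nat) (d : G) (D : L -> L) : L -> L :=
  fun x => xget 0 (delta_graph k d D x).

Definition delta (D : nat -> L -> L) : L -> L :=
  fun x => \sum_(k \in setT) \sum_(d \in setT)
    delta_homogeneous k d (map_component hcomp d (D k)) x.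

(* For every component of D, the value does not depend on the presentation of
   x.  When alpha is not surjective this does not follow from perfect and
   centerless. *)
Definition delta_well_defined (D : nat -> L -> L) : Prop :=
  forall k d x z z',
    delta_graph k d (map_component hcomp d (D k)) x z ->
    delta_graph k d (map_component hcomp d (D k)) x z' -> z = z'.

End Theory.

(* Main.v *)
(** For homogeneous D and D' that commute with alpha, expand delta_D (delta_D' b)
    on a bracket b of homogeneous elements.  The terms in which D and D' act on
    different entries also occur in delta_D' (delta_D b), with the factor
    eps d d', so they cancel in the color commutator; the terms in which both
    act on the same entry give the expression that defines delta_[D, D'] on b.
    As the left-hand side does not depend on the presentation of a vector as a
    sum of brackets, this also shows that delta_[D, D'] is well defined.  The
    general case follows by splitting D and D' into their homogeneous parts. *)
From HB Require Import structures.
Require Import Defs.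
From mathcomp Require Import all_boot all_order all_algebra all_classical.
Set Implicit Arguments.
Unset Strict Implicit.
Unset Printing Implicit Defensive.
(* Defs is imported last because GRing.Theory shadows [multiplicative]. *)
Import GRing.Theory Defs.
Local Open Scope classical_set_scope.
Local Open Scope ring_scope.

(** * Finitely supported sums rewritten as sums over lists and initial segments *)

Lemma fsum_seq (I : choiceType) (V : nmodType) (s : seq I) (F : I -> V) :
  (forall i, i \notin s -> F i = 0) ->
  \sum_(i \in setT) F i = \sum_(i <- undup s) F i.
Proof.
move=> F0; rewrite (fsbigE (undup s)) ?undup_uniq //.
  by apply: eq_bigl => i; rewrite in_setT.
by move=> i _; rewrite mem_undup; exact: F0.
Qed.

Lemma big_nat_support (V : nmodType) (F : nat -> V) (N : nat) :
  (forall k, (N <= k)%N -> F k = 0) ->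
  \sum_(k \in setT) F k = \sum_(k < N) F k.
Proof.
move=> F0; rewrite (@fsum_seq _ _ (index_iota 0 N)) => [|k].
  by rewrite undup_id ?iota_uniq // big_mkord.
by rewrite mem_index_iota /= -leqNgt; exact: F0.
Qed.

Lemma sum_pred1 (I : choiceType) (V : nmodType) (s : seq I) (i : I) (F : I -> V) :
  (i \notin s -> F i = 0) -> \sum_(j <- undup s) (if j == i then F j else 0) = F i.
Proof.
move=> F0; case: (boolP (i \in s)) => si; last first.
  rewrite (F0 si) big1_seq // => j /=; rewrite mem_undup => sj.
  by case: eqP => // ji; rewrite -ji sj in si.
rewrite (bigD1_seq i) ?undup_uniq ?mem_undup //= eqxx big1 ?addr0 // => j.
by move/negPf => ->.
Qed.

(** This handles the Cauchy product in [derivation_bracket]. A pair of indices below [N] has its sum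
    below [N + N], so the antidiagonals up to that bound already meet every nonzero entry of [C]. *)
Lemma sum_antidiagonal (V : nmodType) (N : nat) (C : nat -> nat -> V) :
  (forall i j, (N <= i)%N || (N <= j)%N -> C i j = 0) ->
  \sum_(m < N + N) \sum_(i < m.+1) C i (m - i)%N = \sum_(i < N) \sum_(j < N) C i j.
Proof.
move=> C0.
have step (m : 'I_(N + N)) : \sum_(i < m.+1) C i (m - i)%N =
    \sum_(i < N) \sum_(j < N | (i + j == m)%N) C i j.
  transitivity (\sum_(i < N + N) if (i <= m)%N then C i (m - i)%N else 0).
    rewrite -big_mkcond /=.
    by rewrite (big_ord_widen (N + N) (fun i => C i (m - i)%N)).
  rewrite big_split_ord /= [X in _ + X]big1 ?addr0 => [|i _]; last first.
    by rewrite C0 ?leq_addr //; case: ifP.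
  apply: eq_bigr => i _; case: leqP => im; last first.
    by rewrite big_pred0 // => j; apply/negbTE; rewrite gtn_eqF // ltn_addr.
  case: (ltnP (m - i)%N N) => mi.
    rewrite (big_pred1 (Ordinal mi)) // => j /=.
    by rewrite -val_eqE /= -{1}(subnKC im) eqn_add2l.
  rewrite C0 ?mi ?orbT // big1 // => j /eqP jm.
  by move: (ltn_ord j); rewrite ltnNge -(addKn i j) jm mi.
rewrite (eq_bigr _ (fun m _ => step m)) exchange_big /=; apply: eq_bigr => i _.
rewrite (exchange_big_dep xpredT) //=; apply: eq_bigr => j _.
have ij : (i + j < N + N)%N.
  by rewrite -addSn leq_add // ltnW.
by rewrite (big_pred1 (Ordinal ij)) // => m /=; rewrite -val_eqE /= eq_sym.
Qed.

(** * Linearity as a predicate on bare functions *)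

Section LinearProp.
Variables (K : fieldType) (V W : lmodType K) (f : V -> W).
Hypothesis f_lin : linear f.

Let fl : {linear V -> W} :=
  HB.pack_for {linear V -> W} f (GRing.isLinear.Build K V W *:%R f f_lin).

Lemma linear_at0 : f 0 = 0. Proof. exact: (linear0 fl). Qed.

Lemma linear_atB u v : f (u - v) = f u - f v. Proof. exact: (linearB fl). Qed.

Lemma linear_atZ a u : f (a *: u) = a *: f u. Proof. exact: (linearZ_LR fl). Qed.

Lemma linear_at_sum (I : Type) (r : seq I) (P : pred I) (F : I -> V) :
  f (\sum_(i <- r | P i) F i) = \sum_(i <- r | P i) f (F i).
Proof. exact: (linear_sum fl). Qed.

End LinearProp.

Section LinearClosure.
Variables (K : fieldType) (V W : lmodType K).
Implicit Types f g : V -> W.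

Lemma linear_fun0 : linear (fun _ : V => 0 : W).
Proof. by move=> a u v; rewrite scaler0 addr0. Qed.

Lemma linear_funP a f g : linear f -> linear g -> linear (fun x => a *: f x + g x).
Proof.
move=> lf lg b u v; rewrite lf lg !scalerDr addrACA !scalerA.
by congr (_ + _ + _); rewrite mulrC.
Qed.

Lemma linear_fun_sum (I : Type) (r : seq I) (P : pred I) (F : I -> V -> W) :
  (forall i, P i -> linear (F i)) -> linear (fun x => \sum_(i <- r | P i) F i x).
Proof.
move=> lF a u v; rewrite scaler_sumr -big_split /=.
by apply: eq_bigr => i Pi; rewrite lF.
Qed.

End LinearClosure.

Lemma linear_comp_fun (K : fieldType) (V : lmodType K) (f g : V -> V) :
  linear f -> linear g -> linear (fun x => f (g x)).
Proof. by move=> lf lg a u v; rewrite lg lf. Qed.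

(** * Homogeneous parts of vectors and linear maps *)

Section Grading.
Variables (K : fieldType) (G : zmodType) (L : lmodType K) (V : G -> set L).
Hypothesis gradV : is_grading V.

Lemma hcomp0 g : V g 0. Proof. by have [/(_ g)[]] := gradV. Qed.

Lemma hcompP g a u v : V g u -> V g v -> V g (a *: u + v).
Proof. by have [/(_ g)[_ +] _] := gradV; apply. Qed.

Lemma hcompD g u v : V g u -> V g v -> V g (u + v).
Proof. by move=> Vu Vv; rewrite -[u]scale1r; exact: hcompP. Qed.

Lemma hcompZ g a u : V g u -> V g (a *: u).
Proof. by move=> Vu; rewrite -[_ *: _]addr0; apply: hcompP => //; exact: hcomp0. Qed.

Lemma hcompB g u v : V g u -> V g v -> V g (u - v).
Proof. by move=> Vu Vv; rewrite addrC -scaleN1r; exact: hcompP. Qed.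

Lemma hcomp_sum (I : Type) (r : seq I) (P : pred I) (F : I -> L) g :
  (forall i, P i -> V g (F i)) -> V g (\sum_(i <- r | P i) F i).
Proof. by move=> VF; apply: (big_ind (V g)) => //; [exact: hcomp0|exact: hcompD]. Qed.

Lemma component_decomposition x : is_decomposition V x (fun g => component V g x).
Proof.
by rewrite /component; apply: xgetPex; have [_ /(_ x)[c [? _]]] := gradV; exists c.
Qed.

Lemma component_unique x c g : is_decomposition V x c -> component V g x = c g.
Proof.
move=> xc; have [_ /(_ x)[c' [_ uc']]] := gradV.
by rewrite -(uc' _ xc) (uc' _ (component_decomposition x)).
Qed.

(** Uniqueness of the decomposition in usable form: any family of homogeneous vectors supported in a
    list and summing to [x] is the family of components. *)
Lemma component_seq x c (s : seq G) g :
  (forall h, V h (c h)) -> (forall h, h \notin s -> c h = 0) ->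
  x = \sum_(h <- undup s) c h -> component V g x = c g.
Proof.
move=> Vc c0 xc; apply: component_unique; split => //; last by rewrite (fsum_seq c0).
apply: (@sub_finite_set _ _ [set` s]); last by apply/finite_seqP; exists s.
by move=> h /= ch; apply: contrapT => /negP/c0.
Qed.

Lemma component_in g x : V g (component V g x).
Proof. by have [+ _ _] := component_decomposition x; apply. Qed.

Lemma component_support x : exists s : seq G,
  (forall g, g \notin s -> component V g x = 0) /\
  x = \sum_(g <- undup s) component V g x.
Proof.
have [_ /finite_seqP[s sE] xE] := component_decomposition x.
have s0 g : g \notin s -> component V g x = 0.
  move=> sg; apply: contrapT => xg.
  have : [set` s] g by rewrite -sE.
  by move=> /= sg'; rewrite sg' in sg.
by exists s; split => //; rewrite {1}xE (fsum_seq s0).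
Qed.

Lemma component_id g h x : V g x -> component V h x = if h == g then x else 0.
Proof.
move=> Vx; apply: (@component_seq _ (fun h => if h == g then x else 0) [:: g]).
- by move=> k; case: eqP => [->|_] //; exact: hcomp0.
- by move=> k; rewrite inE => /negPf ->.
- by rewrite /= big_seq1 eqxx.
Qed.

Lemma component_linear g : linear (component V g).
Proof.
move=> a u v; have [s [s0 uE]] := component_support u.
have [t [t0 vE]] := component_support v.
apply: (@component_seq _ (fun g => a *: component V g u + component V g v) (s ++ t)).
- by move=> h; apply: hcompP; exact: component_in.
- move=> h; rewrite mem_cat negb_or => /andP[hs ht].
  by rewrite s0 // t0 // scaler0 addr0.
- rewrite big_split /= -scaler_sumr; congr (_ *: _ + _).
    rewrite -(fsum_seq (s := s ++ t)) ?(fsum_seq s0) // => h.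
    by rewrite mem_cat negb_or => /andP[/s0].
  rewrite -(fsum_seq (s := s ++ t)) ?(fsum_seq t0) // => h.
  by rewrite mem_cat negb_or => /andP[_ /t0].
Qed.

Lemma linear_ext (f f' : L -> L) : linear f -> linear f' ->
  (forall g x, V g x -> f x = f' x) -> f =1 f'.
Proof.
move=> lf lf' ff' x; have [s [_ ->]] := component_support x.
rewrite !linear_at_sum //; apply: eq_bigr => g _.
by apply: (ff' g); exact: component_in.
Qed.

Lemma map_component_hom f d g x :
  linear f -> V g x -> map_component V d f x = component V (g + d) (f x).
Proof.
move=> lf Vx; rewrite /map_component (@fsum_seq _ _ [:: g]) => [|h].
  by rewrite big_seq1 (component_id _ Vx) eqxx.
rewrite inE (component_id _ Vx) => /negPf ->.
by rewrite (linear_at0 lf) (linear_at0 (component_linear _)).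
Qed.

(** The sum defining [map_component] has a support that depends on its argument. A list covering the
    supports of both [u] and [v] also covers that of [a *: u + v], and over this common list
    linearity is termwise. *)
Lemma map_component_linear f d : linear f -> linear (map_component V d f).
Proof.
move=> lf a u v; have [s [s0 _]] := component_support u.
have [t [t0 _]] := component_support v.
pose F g x := component V (g + d) (f (component V g x)).
have lF g : linear (F g).
  by move=> b y z; rewrite /F component_linear lf component_linear.
have FE x : (forall g, g \notin s ++ t -> component V g x = 0) ->
    map_component V d f x = \sum_(g <- undup (s ++ t)) F g x.
  move=> x0; apply: fsum_seq => g /x0 ->.
  by rewrite (linear_at0 lf) (linear_at0 (component_linear _)).
rewrite !FE ?scaler_sumr -?big_split => [||g|g] /=.
- by apply: eq_bigr => g _; rewrite lF.
- move=> g; rewrite mem_cat negb_or => /andP[_]; exact: t0.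
- by rewrite mem_cat negb_or => /andP[+ _]; exact: s0.
- rewrite mem_cat negb_or component_linear => /andP[/s0 -> /t0 ->].
  by rewrite scaler0 addr0.
Qed.

(** The degrees are kept in a list that only has to cover the support, so that lists of several maps
    can be concatenated; [undup] in the sum then removes repetitions. *)
Definition homogeneous_parts (s : seq G) (F : G -> L -> L) (f : L -> L) : Prop :=
  [/\ forall d, linear (F d), forall d, homogeneous_map V d (F d),
      forall d x, d \notin s -> F d x = 0 &
      forall x, f x = \sum_(d <- undup s) F d x].

Lemma homogeneous_parts_linear s F f : homogeneous_parts s F f -> linear f.
Proof.
move=> [lF _ _ fE]; rewrite (_ : f = fun x => \sum_(d <- undup s) F d x).
  exact: linear_fun_sum.
exact/funext.
Qed.

(** On [x] of degree [g] the vectors [F e x] have the pairwise distinct degrees [g + e], so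
    projecting [f x] to degree [g + d] leaves [F d x]. Homogeneous parts are thus determined by the
    map. *)
Lemma homogeneous_parts_component s F f d :
  homogeneous_parts s F f -> map_component V d f = F d.
Proof.
move=> sFf; have lf := homogeneous_parts_linear sFf; have [lF hF F0 fE] := sFf.
apply/funext; apply: linear_ext => [||g x Vx] //; first exact: map_component_linear.
rewrite (map_component_hom _ lf Vx) fE (linear_at_sum (component_linear _)).
rewrite -(sum_pred1 (F := F ^~ x) (F0 d x)); apply: eq_bigr => e _.
rewrite (component_id _ (hF _ _ _ Vx)) (inj_eq (addrI g)) eq_sym.
by case: eqP => // ->.
Qed.

Lemma homogeneous_parts_widen s t F f : {subset s <= t} ->
  homogeneous_parts s F f -> homogeneous_parts t F f.
Proof.
move=> st [lF hF F0 fE]; have F0t d x : d \notin t -> F d x = 0.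
  by move=> dt; apply: F0; apply: contra dt; exact: st.
by split => // x; rewrite fE -!fsum_seq // => d; [exact: F0t|exact: F0].
Qed.

(** The definition of [color_commutator] splits only the second composite into components. Splitting
    the first one too turns the whole into a double sum of commutators of homogeneous parts. *)
Lemma color_commutator_parts (eps : G -> G -> K) s s' F F' f f' :
  homogeneous_parts s F f -> homogeneous_parts s' F' f' ->
  color_commutator eps V f f' = fun x =>
    \sum_(d <- undup s) \sum_(d' <- undup s')
      (F d (F' d' x) - eps d d' *: F' d' (F d x)).
Proof.
move=> sF sF'; apply/funext => x; have [lF _ F0 fE] := sF.
have [lF' _ F0' fE'] := sF'.
rewrite /color_commutator (@fsum_seq _ _ s) => [|d ds]; last first.
  rewrite fsbig1 // => d' _; rewrite (homogeneous_parts_component d sF) F0 //.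
  by rewrite (homogeneous_parts_component d' sF') (linear_at0 (lF' _)) scaler0.
rewrite fE -sumrB; apply: eq_bigr => d _.
rewrite fE' (linear_at_sum (lF _)) (@fsum_seq _ _ s') => [|d' ds].
  rewrite -sumrB; apply: eq_bigr => d' _.
  by rewrite (homogeneous_parts_component d sF) (homogeneous_parts_component d' sF').
by rewrite (homogeneous_parts_component d' sF') F0' ?scaler0.
Qed.

End Grading.

(** * Leibniz expressions of brackets *)

Section Dfwith.
Variables (I : eqType) (T T' : Type).
Implicit Types (x : I -> T) (i j : I).

Lemma dfwith_same x i : dfwith x i (x i) = x.
Proof. by apply/funext => j; case: dfwithP. Qed.

Lemma dfwith_twice x i u v : dfwith (dfwith x i u) i v = dfwith x i v.
Proof.
apply/funext => j; have [->|ij] := eqVneq j i; first by rewrite !dfwithin.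
by rewrite !dfwithout // eq_sym.
Qed.

Lemma dfwithC x i j u v : i != j ->
  dfwith (dfwith x i u) j v = dfwith (dfwith x j v) i u.
Proof.
move=> ij; apply/funext => l; have [->|lj] := eqVneq l j.
  by rewrite dfwithin dfwithout // dfwithin.
rewrite dfwithout 1?eq_sym //; have [->|li] := eqVneq l i; first by rewrite !dfwithin.
by rewrite !dfwithout // eq_sym.
Qed.

Lemma comp_dfwith (f : T -> T') x i v :
  f \o dfwith x i v = dfwith (f \o x) i (f v).
Proof.
apply/funext => j /=; have [->|ij] := eqVneq j i; first by rewrite !dfwithin.
by rewrite !dfwithout // eq_sym.
Qed.

End Dfwith.

(** Degree bookkeeping: when a map of degree [d] acts on entry [t], a partial sum of degrees grows
    by [d] exactly when it includes [t]. *)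
Lemma sum_dfwith (I : finType) (V : nmodType) (g : I -> V) (t : I) (d : V)
    (P : pred I) :
  \sum_(i | P i) dfwith g t (g t + d) i =
  \sum_(i | P i) g i + (if P t then d else 0).
Proof.
have gE i : i != t -> dfwith g t (g t + d) i = g i.
  by move=> it; rewrite dfwithout // eq_sym.
case Pt: (P t).
  rewrite (bigD1 t) // [in RHS](bigD1 t) //= dfwithin addrAC; congr (_ + _ + _).
  by apply: eq_bigr => i /andP[_ /gE].
rewrite addr0; apply: eq_bigr => i Pi; apply: gE.
by apply: contraTneq Pi => ->; rewrite Pt.
Qed.

Section Leibniz.
Variables (K : fieldType) (G : zmodType) (eps : G -> G -> K) (n : nat).
Variables (L : lmodType K) (A : nHomLieColor eps n L).
Local Notation V := (hcomp A).
Local Notation br := (br A).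
Local Notation alpha := (alpha A).
Local Notation gradV := (hom_grading A).
Implicit Types (f D : L -> L) (g : 'I_n -> G) (u : 'I_n -> L).

(** The contribution of a single bracket to the value in [delta_graph]. *)
Definition leibniz k d D g u : L :=
  \sum_(t < n) eps d (\sum_(s < n | (s < t)%N) g s) *:
    br (dfwith (iter k alpha \o u) t (D (u t))).

Definition commutes_with_alpha f := forall x, f (alpha x) = alpha (f x).

Lemma br_linear u i : linear (fun x => br (dfwith u i x)).
Proof. by move=> a x y; exact: br_multilinear. Qed.

Lemma iter_alpha_linear k : linear (iter k alpha).
Proof. by elim: k => [|k IHk] a x y //=; rewrite IHk alpha_linear. Qed.

Lemma iter_alpha_even k h x : V h x -> V h (iter k alpha x).
Proof.
by move=> Vx; elim: k => //= k IHk; rewrite -[h]addr0; exact: alpha_even.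
Qed.

Lemma iter_alpha_comm k f x :
  commutes_with_alpha f -> f (iter k alpha x) = iter k alpha (f x).
Proof. by move=> fa; elim: k => //= k IHk; rewrite fa IHk. Qed.

Lemma iter_alpha_comp k k' u :
  iter k alpha \o (iter k' alpha \o u) = iter (k + k') alpha \o u.
Proof. by apply/funext => i /=; rewrite iterD. Qed.

Lemma leibniz_sum k d (I : Type) (r : seq I) (P : pred I) (D : I -> L -> L) g u :
  leibniz k d (fun x => \sum_(i <- r | P i) D i x) g u =
  \sum_(i <- r | P i) leibniz k d (D i) g u.
Proof.
rewrite /leibniz exchange_big /=; apply: eq_bigr => t _.
by rewrite (linear_at_sum (br_linear _ t)) scaler_sumr.
Qed.

Lemma br_scale u i a : br (dfwith u i (a *: u i)) = a *: br u.
Proof. by rewrite (linear_atZ (br_linear u i)) dfwith_same. Qed.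

Lemma leibniz_scale k d D g u i a : linear D ->
  leibniz k d D g (dfwith u i (a *: u i)) = a *: leibniz k d D g u.
Proof.
move=> lD; rewrite /leibniz scaler_sumr; apply: eq_bigr => t _.
rewrite scalerA mulrC -scalerA; congr (_ *: _).
(* For [t = i] the scalar passes through [D]; otherwise it sits in another entry and passes through
   the power of [alpha]. *)
rewrite comp_dfwith; have [->|ti] := eqVneq t i.
  by rewrite dfwithin dfwith_twice (linear_atZ lD) (linear_atZ (br_linear _ _)).
rewrite dfwithout 1?eq_sym // (linear_atZ (iter_alpha_linear k)).
rewrite dfwithC 1?eq_sym // (linear_atZ (br_linear _ _)).
by rewrite [X in dfwith _ i X](_ : _ = dfwith (iter k alpha \o u) t (D (u t)) i)
  ?dfwith_same // dfwithout.
Qed.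

Lemma dfwith_homogeneous k d D g u t :
  homogeneous_map V d D -> (forall i, V (g i) (u i)) ->
  forall i, V (dfwith g t (g t + d) i) (dfwith (iter k alpha \o u) t (D (u t)) i).
Proof.
move=> hD Vu i; have [->|it] := eqVneq i t.
  by rewrite !dfwithin; apply: hD.
by rewrite !dfwithout 1?eq_sym //=; exact: iter_alpha_even.
Qed.

Lemma leibniz_homogeneous k d D g u :
  homogeneous_map V d D -> (forall i, V (g i) (u i)) ->
  V (\sum_i g i + d) (leibniz k d D g u).
Proof.
move=> hD Vu; apply: (hcomp_sum gradV) => t _; apply: (hcompZ gradV).
by rewrite -(sum_dfwith g t d xpredT); apply: br_graded; exact: dfwith_homogeneous.
Qed.

Section Composition.
Hypothesis heps : skew_bicharacter eps.

Lemma bichar_0r d : eps d 0 = 1.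
Proof.
apply: (mulfI (bichar_neq0 heps d 0)).
by rewrite mulr1 -(bicharDr heps) addr0.
Qed.

(** Here [t] is the entry hit by [f'] and [r] the entry hit by [f]. The terms [r = t] form the
    expression of the composite. For [r != t], the degree of entry [t] has been raised by [d'], and
    this is seen by [f] only when [t] precedes [r], whence the factor [eps d d'] in that case. *)
Lemma leibniz_comp k k' d d' f f' (delta : L -> L) g u :
  homogeneous_map V d' f' -> commutes_with_alpha f -> linear delta ->
  (forall h v, (forall i, V (h i) (v i)) -> delta (br v) = leibniz k d f h v) ->
  (forall i, V (g i) (u i)) ->
  let S (t : 'I_n) := \sum_(s < n | (s < t)%N) g s in
  let w := iter (k + k') alpha \o u in
  delta (leibniz k' d' f' g u) =
  leibniz (k + k') (d + d') (f \o f') g u +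
  \sum_(t < n) \sum_(r < n | r != t)
    (eps d' (S t) * eps d (S r) * (if (t < r)%N then eps d d' else 1)) *:
    br (dfwith (dfwith w t (iter k alpha (f' (u t)))) r (iter k' alpha (f (u r)))).
Proof.
move=> hf' fa ldelta deltaE Vu S w.
rewrite (linear_at_sum ldelta) -big_split /=; apply: eq_bigr => t _.
rewrite (linear_atZ ldelta) (deltaE _ _ (dfwith_homogeneous k' t hf' Vu)).
rewrite scaler_sumr (bigD1 t) //=; congr (_ + _).
  rewrite sum_dfwith ltnn addr0 scalerA dfwithin comp_dfwith dfwith_twice.
  by rewrite iter_alpha_comp (bicharDl heps) mulrC.
apply: eq_bigr => r rt; rewrite scalerA sum_dfwith.
rewrite comp_dfwith dfwithout 1?eq_sym // iter_alpha_comp /= (iter_alpha_comm _ _ fa).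
rewrite (bicharDr heps) mulrA; congr (_ * _ *: _).
by case: ifP => // _; exact: bichar_0r.
Qed.

(* The terms in which D and D' hit different entries occur in both
   compositions and cancel. *)
Lemma leibniz_commutator k k' d d' f f' (delta delta' : L -> L) g u :
  homogeneous_map V d f -> homogeneous_map V d' f' ->
  commutes_with_alpha f -> commutes_with_alpha f' ->
  linear delta -> linear delta' ->
  (forall h v, (forall i, V (h i) (v i)) -> delta (br v) = leibniz k d f h v) ->
  (forall h v, (forall i, V (h i) (v i)) -> delta' (br v) = leibniz k' d' f' h v) ->
  (forall i, V (g i) (u i)) ->
  delta (delta' (br u)) - eps d d' *: delta' (delta (br u)) =
  leibniz (k + k') (d + d') (fun x => f (f' x) - eps d d' *: f' (f x)) g u.
Proof.
move=> hf hf' fa fa' ld ld' dE dE' Vu.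
rewrite (dE _ _ Vu) (dE' _ _ Vu).
rewrite (leibniz_comp k' hf' fa ld dE Vu) (leibniz_comp k hf fa' ld' dE' Vu).
rewrite [(k' + k)%N]addnC [d' + d]addrC.
(* In the second composite the outer index is the entry hit by [f]. After the exchange both mixed
   sums are indexed first by the entry hit by [f']. *)
rewrite [X in _ - _ *: (_ + X)](exchange_big_dep xpredT) //=.
rewrite scalerDr opprD addrACA [X in _ + X](_ : _ = 0) ?addr0.
  rewrite scaler_sumr -sumrB; apply: eq_bigr => t _ /=.
  rewrite (linear_atB (br_linear _ _)) (linear_atZ (br_linear _ _)).
  by rewrite scalerBr; congr (_ - _); rewrite !scalerA mulrC.
apply/eqP; rewrite subr_eq0; apply/eqP; rewrite scaler_sumr; apply: eq_bigr => t _.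
rewrite scaler_sumr; apply: eq_big => [r|r rt]; first by rewrite eq_sym.
rewrite scalerA dfwithC 1?eq_sym //; congr (_ *: _).
(* If [t] precedes [r], the factor [eps d d'] comes from the first composite on one side and from
   the commutator on the other. If [r] precedes [t], the commutator factor meets [eps d' d], and
   skew-symmetry makes their product 1. *)
case: (ltngtP t r) => tr; last by rewrite (val_inj tr) eqxx in rt.
  by rewrite mulr1 mulrC; congr (_ * _); rewrite mulrC.
rewrite mulr1 mulrCA (bichar_skew heps) mulr1; exact: mulrC.
Qed.

End Composition.

(** * Presentations of vectors as sums of brackets *)

Lemma delta_graph0 k d D : delta_graph A k d D 0 0.
Proof.
exists 0, (fun _ _ => 0), (fun _ _ => 0); split; rewrite ?big_ord0 //.
by case.
Qed.

Lemma delta_graph_br k d D g u : (forall i, V (g i) (u i)) ->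
  delta_graph A k d D (br u) (leibniz k d D g u).
Proof. by move=> Vu; exists 1%N, (fun=> g), (fun=> u); rewrite !big_ord1. Qed.

(** Presentations are concatenated. They carry no coefficients, so [a] is absorbed into the first
    entry of each bracket, which exists because [n] is positive. *)
Lemma delta_graphP k d D a x z x' z' : (0 < n)%N -> linear D ->
  delta_graph A k d D x z -> delta_graph A k d D x' z' ->
  delta_graph A k d D (a *: x + x') (a *: z + z').
Proof.
move=> n0 lD [m [g [u [Vu -> ->]]]] [m' [g' [u' [Vu' -> ->]]]].
pose i0 := Ordinal n0.
exists (m + m')%N,
  (fun i => match fintype.split i with inl j => g j | inr j => g' j end),
  (fun i => match fintype.split i with
            | inl j => dfwith (u j) i0 (a *: u j i0) | inr j => u' j end).
have splitl (i : 'I_m) : fintype.split (lshift m' i) = inl i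
  by exact: (unsplitK (inl i)).
have splitr (i : 'I_m') : fintype.split (rshift m i) = inr i
  by exact: (unsplitK (inr i)).
split.
- move=> i t; case: (fintype.split i) => j //; case: dfwithP => //.
  exact: (hcompZ gradV).
- rewrite big_split_ord scaler_sumr /=; congr (_ + _); apply: eq_bigr => i _.
    by rewrite splitl br_scale.
  by rewrite splitr.
- rewrite big_split_ord scaler_sumr /=; congr (_ + _); apply: eq_bigr => i _.
    by rewrite splitl; exact/esym/leibniz_scale.
  by rewrite splitr.
Qed.

Lemma homogeneous_brackets_span (S : set L) : is_subspace S ->
  (forall g u, (forall i, V (g i) (u i)) -> S (br u)) -> forall u, S (br u).
Proof.
move=> [S0 SP] Shom u.
(* Induction on the number [j] of leading entries that may be inhomogeneous; the step splits the
   last of them, entry [j], into its components. *)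
suff H j : (j <= n)%N -> forall u, (forall i : 'I_n, (j <= i)%N ->
    exists h, V h (u i)) -> S (br u).
  by apply: (H n) => // i; rewrite leqNgt ltn_ord.
elim: j => [_ {}u Vu|j IHj jn {}u Vu].
  by have [g Vg] := choice (fun i => Vu i (leq0n _)); apply: (Shom g).
pose i := Ordinal jn; have [s [_ uE]] := component_support gradV (u i).
rewrite -(dfwith_same u i) uE (linear_at_sum (br_linear u i)).
have SD x y : S x -> S y -> S (x + y) by rewrite -{2}[x]scale1r; exact: SP.
apply: (big_ind S) => // h _; apply: IHj => [|l jl]; first exact: ltnW.
have [->|li] := eqVneq l i.
  by rewrite dfwithin; exists h; exact: (component_in gradV).
rewrite dfwithout 1?eq_sym //; apply: Vu.
by rewrite ltn_neqAle jl andbT; apply: contra li => /eqP jl'; apply/eqP/val_inj.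
Qed.

(** The derived algebra is a generated subalgebra, but the linear span of all brackets is already
    closed under the bracket and, by multiplicativity, under [alpha]. Hence perfection makes every
    vector a linear combination of brackets, and brackets of homogeneous elements suffice. *)
Lemma perfect_ind (S : set L) : perfect A -> multiplicative A -> is_subspace S ->
  (forall g u, (forall i, V (g i) (u i)) -> S (br u)) -> forall x, S x.
Proof.
move=> hperf hmult hS Shom x; have Sbr := homogeneous_brackets_span hS Shom.
pose T := linear_span (range br).
have [T0 TP] : is_subspace T.
  split; first by move=> M [[M0 _] _].
  move=> a y z Ty Tz M hM; have [[_ MP] _] := hM.
  by apply: MP; [exact: Ty|exact: Tz].
have brT u : T (br u) by move=> M [_]; apply; exists u.
have TL : is_subalgebra A T.
  split=> // y Ty.
  (* Stability of the span under [alpha] follows from its minimality, applied to the subspace of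
     those vectors in [T] whose image stays in [T]. *)
  pose M := T `&` (alpha @^-1` T).
  have /(_ M) : T y by [].
  case=> //; split.
    split; first by split=> //=; rewrite (linear_at0 (alpha_linear A)).
    move=> a v w [Tv Tav] [Tw Taw]; split; first exact: TP.
    by rewrite /= alpha_linear; exact: TP.
  by move=> _ [u _ <-]; split => //=; rewrite hmult.
have Tx : T x.
  have : derived_algebra A x by rewrite hperf.
  by apply; split => // _ [u _ <-]; exact: brT.
by apply: Tx; split => // _ [u _ <-]; exact: Sbr.
Qed.

End Leibniz.

(** * The maps delta_D *)

Section Delta.
Variables (K : fieldType) (G : zmodType) (eps : G -> G -> K) (n : nat).
Variables (L : lmodType K) (A : nHomLieColor eps n L).
Hypotheses (n_gt0 : (0 < n)%N).
Hypotheses (hperf : perfect A) (hmult : multiplicative A).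
Local Notation V := (hcomp A).
Local Notation br := (br A).
Local Notation gradV := (hom_grading A).

Lemma delta_graph_total k d D x : linear D -> exists z, delta_graph A k d D x z.
Proof.
move=> lD; move: x; apply: (@perfect_ind _ _ _ _ _ A
  [set x | exists z, delta_graph A k d D x z]) => //=; last first.
  by move=> g u Vu; eexists; exact: delta_graph_br.
split; first by exists 0; exact: delta_graph0.
move=> a x x' [z xz] [z' xz']; exists (a *: z + z').
exact: delta_graphP.
Qed.

(** From any presentation of [x] only the brackets of total degree [g] are kept: projecting to
    degree [g] fixes [x] and kills the others. The value on the remaining brackets has degree
    [g + d]. *)
Lemma delta_graph_homogeneous k d D g x : homogeneous_map V d D -> linear D ->
  V g x -> exists2 z, delta_graph A k d D x z & V (g + d) z.
Proof.
move=> hD lD Vx; have [_ [m [h [u [Vu xE _]]]]] := delta_graph_total k d x lD.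
pose P z y := delta_graph A k d D y z /\ V (g + d) z.
pose c i := \sum_t h i t == g.
exists (\sum_(i < m) if c i then leibniz A k d D (h i) (u i) else 0).
  have -> : x = \sum_(i < m) if c i then br (u i) else 0.
    have {1}-> : x = component V g x by rewrite (component_id gradV _ Vx) eqxx.
    rewrite {1}xE (linear_at_sum (component_linear gradV g)).
    apply: eq_bigr => i _; rewrite (component_id gradV _ (br_graded (Vu i))).
    by rewrite /c eq_sym.
  apply: (big_ind2 (delta_graph A k d D)) => [|y z y' z' yz yz'|i _].
  - exact: delta_graph0.
  - by rewrite -[y]scale1r -[z]scale1r; exact: delta_graphP.
  - by case: ifP => _; [exact: delta_graph_br|exact: delta_graph0].
apply: (hcomp_sum gradV) => i _; case: ifP => [/eqP <-|_].
  exact: leibniz_homogeneous.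
exact: (hcomp0 gradV).
Qed.

(** Both the default of [xget] and every value in the graph are 0, so no choice matters. *)
Lemma delta_homogeneous0 k d D x :
  (forall y, D y = 0) -> delta_homogeneous A k d D x = 0.
Proof.
move=> D0; rewrite /delta_homogeneous; case: xgetP => // z _ [m [g [u [_ _ ->]]]].
rewrite big1 // => i _; rewrite big1 // => t _.
by rewrite D0 (linear_at0 (br_linear _ _ t)) scaler0.
Qed.

Section WellDefined.
Variables (k : nat) (d : G) (D : L -> L).
Hypothesis lD : linear D.
Hypothesis graph_fun : forall x z z',
  delta_graph A k d D x z -> delta_graph A k d D x z' -> z = z'.
Local Notation deltaD := (delta_homogeneous A k d D).

Lemma delta_homogeneous_eq x z : delta_graph A k d D x z -> deltaD x = z.
Proof. by move=> xz; apply: xget_unique => // z' /graph_fun; apply. Qed.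

Lemma delta_homogeneous_graph x : delta_graph A k d D x (deltaD x).
Proof.
by have [z xz] := delta_graph_total k d x lD; rewrite (delta_homogeneous_eq xz).
Qed.

Lemma delta_homogeneous_linear : linear deltaD.
Proof.
move=> a x y; apply: delta_homogeneous_eq; apply: delta_graphP => //;
  exact: delta_homogeneous_graph.
Qed.

Lemma delta_homogeneous_br g u : (forall i, V (g i) (u i)) ->
  deltaD (br u) = leibniz A k d D g u.
Proof. by move=> Vu; apply: delta_homogeneous_eq; exact: delta_graph_br. Qed.

Lemma delta_homogeneous_homogeneous :
  homogeneous_map V d D -> homogeneous_map V d deltaD.
Proof.
move=> hD g x Vx; have [z xz Vz] := delta_graph_homogeneous k hD lD Vx.
by rewrite (delta_homogeneous_eq xz).
Qed.

End WellDefined.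

(** The maps with finitely many homogeneous parts, all commuting with [alpha], form a subspace
    containing the double derivations, hence contain their span. *)
Lemma double_derivation_parts k D : double_derivations A k D ->
  exists s F, homogeneous_parts V s F D /\ forall d, commutes_with_alpha A (F d).
Proof.
pose M := [set f | exists s F,
  homogeneous_parts V s F f /\ forall d, commutes_with_alpha A (F d)].
move=> /(_ M); apply; split => [|f [d [lf hf fa _]]]; last first.
  exists [:: d], (fun e => if e == d then f else fun=> 0); split; last first.
    move=> e; case: eqP => _ x; last by rewrite (linear_at0 (alpha_linear A)).
    exact: (congr1 (@^~ x) fa).
  split => [e|e|e x|x].
  - by case: eqP => // _; exact: linear_fun0.
  - by case: eqP => [->//|_] g x _; exact: (hcomp0 gradV).
  - by rewrite inE => /negPf ->.
  - by rewrite big_seq1 eqxx.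
split.
  exists [::], (fun _ _ => 0); split; last first.
    by move=> d x; rewrite (linear_at0 (alpha_linear A)).
  split => // [d|d g x _|x]; [exact: linear_fun0|exact: (hcomp0 gradV)|].
  by rewrite big_nil.
move=> a f f' [s [F [sF Fa]]] [s' [F' [sF' Fa']]].
exists (s ++ s'), (fun d x => a *: F d x + F' d x); split; last first.
  by move=> d x; rewrite Fa Fa' alpha_linear.
have sub1 : {subset s <= s ++ s'} by move=> d ds; rewrite mem_cat ds.
have sub2 : {subset s' <= s ++ s'} by move=> d ds; rewrite mem_cat ds orbT.
have [lF hF F0 fE] := homogeneous_parts_widen sub1 sF.
have [lF' hF' F0' fE'] := homogeneous_parts_widen sub2 sF'.
split => [d|d g x Vx|d x ds|x].
- exact: linear_funP.
- by apply: (hcompP gradV); [exact: hF|exact: hF'].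
- by rewrite F0 // F0' // scaler0 addr0.
- by rewrite big_split -scaler_sumr -fE -fE'.
Qed.

(** One bound and one list of degrees serve all exponents at once, because only finitely many
    components of [D] are nonzero. *)
Lemma all_double_derivations_parts D : all_double_derivations A D ->
  exists N s, [/\ forall k,
      homogeneous_parts V s (fun d => map_component V d (D k)) (D k),
    forall k d, commutes_with_alpha A (map_component V d (D k)) &
    forall k d x, (N <= k)%N -> map_component V d (D k) x = 0].
Proof.
move=> [dD /finite_seqP[r rE]].
have [s sP] := choice (fun k => double_derivation_parts (dD k)).
have {sP} [F sF] := choice sP.
have FE k d : map_component V d (D k) = F k d.
  by have [+ _] := sF k; exact: (homogeneous_parts_component gradV).
have D0 k : k \notin r -> D k = 0.
  move=> kr; apply: contrapT => Dk; have : [set` r] k by rewrite -rE.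
  by move=> /= kr'; rewrite kr' in kr.
have F0 k d x : k \notin r -> F k d x = 0.
  move=> /D0 Dk; rewrite -FE Dk /map_component fsbig1 // => g _.
  exact: (linear_at0 (component_linear gradV _)).
(* The bound lies one past the largest exponent in the support; the list joins the degrees occurring
   at those exponents. *)
exists (\max_(k <- r) k).+1, (flatten [seq s k | k <- r]).
split=> [k|k d|k d x Nk]; rewrite ?FE.
- rewrite (_ : (fun d => _) = F k); last by apply/funext => d; exact: FE.
  case: (boolP (k \in r)) => kr.
    have [+ _] := sF k; apply: homogeneous_parts_widen => d ds.
    by apply/flatten_mapP; exists k.
  have [[lF hF _ _] _] := sF k; split=> // [d x _|x]; first exact: F0.
  by rewrite D0 // big1 // => d _; exact: F0.
- by have [_ +] := sF k; apply.
- apply: F0; apply: contraL Nk => kr; rewrite -ltnNge ltnS.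
  exact: (leq_bigmax_seq (P := xpredT) (F := id)).
Qed.

End Delta.

(** * Compatibility of delta with the color commutator *)

Section Homomorphism.
Variables (K : fieldType) (G : zmodType) (eps : G -> G -> K) (n : nat).
Variables (L : lmodType K) (A : nHomLieColor eps n L).
Hypotheses (n_gt0 : (0 < n)%N) (heps : skew_bicharacter eps).
Hypotheses (hperf : perfect A) (hmult : multiplicative A).
Local Notation V := (hcomp A).
Local Notation br := (br A).
Local Notation gradV := (hom_grading A).
Variables (N : nat) (s : seq G).

Section OneFamily.
Variable D : nat -> L -> L.
Let F k d := map_component V d (D k).
Let del k d := delta_homogeneous A k d (F k d).
Hypothesis DF : forall k, homogeneous_parts V s (F k) (D k).
Hypothesis F0 : forall k d x, (N <= k)%N -> F k d x = 0.
Hypothesis wdD : delta_well_defined A D.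

Let lF k d : linear (F k d). Proof. by have [] := DF k. Qed.
Let hF k d : homogeneous_map V d (F k d). Proof. by have [] := DF k. Qed.

Lemma delta_piece_linear k d : linear (del k d).
Proof. exact: (delta_homogeneous_linear _ _ _ (lF k d) (@wdD k d)). Qed.

Lemma delta_piece_homogeneous k d : homogeneous_map V d (del k d).
Proof. exact: (delta_homogeneous_homogeneous _ _ _ (lF k d) (@wdD k d)). Qed.

Lemma delta_piece_out k d x : (N <= k)%N || (d \notin s) -> del k d x = 0.
Proof.
move=> /orP kd; apply: delta_homogeneous0 => y.
by case: kd => [/F0|ds] //; have [_ _ + _] := DF k; apply.
Qed.

Lemma delta_parts :
  homogeneous_parts V s (fun d x => \sum_(k < N) del k d x) (delta A D).
Proof.
split=> [d|d g x Vx|d x ds|x].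
- by apply: linear_fun_sum => k _; exact: delta_piece_linear.
- by apply: (hcomp_sum gradV) => k _; exact: delta_piece_homogeneous.
- by rewrite big1 // => k _; rewrite delta_piece_out // ds orbT.
- rewrite exchange_big /= /delta (@big_nat_support _ _ N) => [|k Nk].
    apply: eq_bigr => k _; apply: fsum_seq => d ds.
    by rewrite [LHS]delta_piece_out // ds orbT.
  by rewrite fsbig1 // => d _; rewrite [LHS]delta_piece_out // Nk.
Qed.

End OneFamily.

Let degrees := [seq d + d' | d <- undup s, d' <- undup s].

(** Each pair has exactly one total degree, and it occurs in [degrees], so grouping pairs by total
    degree counts each pair once. *)
Lemma sum_by_degree (X : G -> G -> L) :
  \sum_(e <- undup degrees) \sum_(d <- undup s)
    \sum_(d' <- undup s | d + d' == e) X d d' =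
  \sum_(d <- undup s) \sum_(d' <- undup s) X d d'.
Proof.
rewrite exchange_big /=; apply: eq_big_seq => d sd.
rewrite (exchange_big_dep xpredT) //=; apply: eq_big_seq => d' sd'.
rewrite big_mkcond /= -[RHS](sum_pred1 (s := degrees) (i := d + d')
  (F := fun=> X d d')) => [|/negP[]]; last exact: allpairs_f.
by apply: eq_bigr => e _; rewrite eq_sym.
Qed.

Lemma sum_degree_out (X : G -> G -> L) e : e \notin degrees ->
  \sum_(d <- undup s) \sum_(d' <- undup s | d + d' == e) X d d' = 0.
Proof.
move=> es; rewrite big1_seq // => d /= sd.
rewrite big1_seq // => d' /= /andP[/eqP de sd'].
by case/negP: es; rewrite -de; exact: allpairs_f.
Qed.

Variables D1 D2 : nat -> L -> L.
Let F1 k d := map_component V d (D1 k).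
Let F2 k d := map_component V d (D2 k).
Hypothesis DF1 : forall k, homogeneous_parts V s (F1 k) (D1 k).
Hypothesis DF2 : forall k, homogeneous_parts V s (F2 k) (D2 k).
Hypothesis F1a : forall k d, commutes_with_alpha A (F1 k d).
Hypothesis F2a : forall k d, commutes_with_alpha A (F2 k d).
Hypothesis F10 : forall k d x, (N <= k)%N -> F1 k d x = 0.
Hypothesis F20 : forall k d x, (N <= k)%N -> F2 k d x = 0.
Hypothesis wd1 : delta_well_defined A D1.
Hypothesis wd2 : delta_well_defined A D2.

Let lF1 k d : linear (F1 k d). Proof. by have [] := DF1 k. Qed.
Let hF1 k d : homogeneous_map V d (F1 k d). Proof. by have [] := DF1 k. Qed.
Let lF2 k d : linear (F2 k d). Proof. by have [] := DF2 k. Qed.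
Let hF2 k d : homogeneous_map V d (F2 k d). Proof. by have [] := DF2 k. Qed.

Let del1 k d := delta_homogeneous A k d (F1 k d).
Let del2 k d := delta_homogeneous A k d (F2 k d).
Let ldel1 k d : linear (del1 k d). Proof. exact: delta_piece_linear. Qed.
Let ldel2 k d : linear (del2 k d). Proof. exact: delta_piece_linear. Qed.

(** [B] is the commutator of two homogeneous parts and [C] that of their delta maps. On brackets of
    homogeneous elements, [C] is the Leibniz expression of [B] with exponent [k + k'] and degree
    [d + d']. *)
Let B k d k' d' x := F1 k d (F2 k' d' x) - eps d d' *: F2 k' d' (F1 k d x).
Let C k d k' d' x := del1 k d (del2 k' d' x) - eps d d' *: del2 k' d' (del1 k d x).

Let comm_linear (f f' : L -> L) a :
  linear f -> linear f' -> linear (fun x => f (f' x) - a *: f' (f x)).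
Proof.
move=> lf lf'.
rewrite (_ : (fun x => _) = fun x => - a *: f' (f x) + f (f' x)); last first.
  by apply/funext => x; rewrite addrC scaleNr.
by apply: linear_funP; exact: linear_comp_fun.
Qed.

Lemma commutator_linear k d k' d' : linear (B k d k' d').
Proof. exact: comm_linear. Qed.

Lemma delta_commutator_linear k d k' d' : linear (C k d k' d').
Proof. exact: comm_linear. Qed.

Lemma delta_commutator_out k d k' d' x :
  (N <= k)%N || (N <= k')%N -> C k d k' d' x = 0.
Proof.
rewrite /C; case/orP => Nk.
  rewrite /del1 (delta_piece_out DF1 F10) ?Nk //.
  by rewrite (delta_piece_out DF1 F10) ?Nk // (linear_at0 (@ldel2 _ _)) scaler0 subr0.
rewrite /del2 (delta_piece_out DF2 F20) ?Nk //.
by rewrite (delta_piece_out DF2 F20) ?Nk // (linear_at0 (@ldel1 _ _)) scaler0 subr0.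
Qed.

(** The part of degree [e] of the bracket at exponent [m]. *)
Let E m e x := \sum_(k < m.+1) \sum_(d <- undup s)
  \sum_(d' <- undup s | d + d' == e) B k d (m - k)%N d' x.

Lemma derivation_bracket_parts m :
  homogeneous_parts V degrees (E m) (derivation_bracket A D1 D2 m).
Proof.
split=> [e|e g x Vx|e x es|x].
- apply: linear_fun_sum => k _; apply: linear_fun_sum => d _.
  by apply: linear_fun_sum => d' _; exact: commutator_linear.
- apply: (hcomp_sum gradV) => k _; apply: (hcomp_sum gradV) => d _.
  apply: (hcomp_sum gradV) => d' /eqP <-; apply: (hcompB gradV).
    by rewrite [d + d']addrC addrA; apply: hF1; apply: hF2.
  by apply: (hcompZ gradV); rewrite addrA; apply: hF2; apply: hF1.
- by rewrite /E big1 // => k _; exact: sum_degree_out.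
- rewrite exchange_big /=; apply: eq_bigr => k _.
  rewrite (color_commutator_parts gradV eps (DF1 k) (DF2 _)).
  by rewrite -[LHS](sum_by_degree (fun d d' => B k d (m - k)%N d' x)).
Qed.

(** The right-hand side mentions no presentation of [x], so this formula also gives the uniqueness
    of the value for the bracket. *)
Lemma delta_graph_bracket m e x z : delta_graph A m e (E m e) x z ->
  z = \sum_(k < m.+1) \sum_(d <- undup s)
        \sum_(d' <- undup s | d + d' == e) C k d (m - k)%N d' x.
Proof.
move=> [p [g [u [Vu -> ->]]]].
transitivity (\sum_(i < p) \sum_(k < m.+1) \sum_(d <- undup s)
    \sum_(d' <- undup s | d + d' == e) C k d (m - k)%N d' (br (u i))).
  apply: eq_bigr => i _; rewrite -/(leibniz A m e (E m e) (g i) (u i)).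
  rewrite leibniz_sum; apply: eq_bigr => k _; rewrite leibniz_sum.
  apply: eq_bigr => d _; rewrite leibniz_sum; apply: eq_bigr => d' /eqP <-.
  have km : (k <= m)%N by rewrite -ltnS.
  (* Writing [m] as [k + (m - k)] exhibits the exponent of the commutator of the two parts. *)
  rewrite -{1}(subnKC km); apply/esym/leibniz_commutator => //.
    by move=> h v Vv; apply: delta_homogeneous_br => //; exact: (@wd1 k d).
  by move=> h v Vv; apply: delta_homogeneous_br => //; exact: (@wd2 (m - k)%N d').
rewrite exchange_big /=; apply: eq_bigr => k _.
rewrite exchange_big /=; apply: eq_bigr => d _.
rewrite exchange_big /=; apply: eq_bigr => d' _.
by rewrite (linear_at_sum (@delta_commutator_linear _ _ _ _)).
Qed.

Lemma delta_derivation_bracket x :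
  delta A (derivation_bracket A D1 D2) x =
  \sum_(k < N) \sum_(k' < N) \sum_(d <- undup s) \sum_(d' <- undup s) C k d k' d' x.
Proof.
pose S k k' := \sum_(d <- undup s) \sum_(d' <- undup s) C k d k' d' x.
rewrite -[RHS](@sum_antidiagonal _ N S) => [|k k' kk']; last first.
  by rewrite /S big1 // => d _; rewrite big1 // => d' _; exact: delta_commutator_out.
have delE m e : delta_homogeneous A m e
      (map_component V e (derivation_bracket A D1 D2 m)) x =
    \sum_(k < m.+1) \sum_(d <- undup s)
        \sum_(d' <- undup s | d + d' == e) C k d (m - k)%N d' x.
  rewrite (homogeneous_parts_component gradV e (derivation_bracket_parts m)).
  have lE : linear (E m e) by have [+ _ _ _] := derivation_bracket_parts m.
  have [z xz] := delta_graph_total n_gt0 hperf hmult m e x lE.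
  rewrite -(delta_graph_bracket xz); apply: xget_unique => // z' xz'.
  by rewrite (delta_graph_bracket xz) (delta_graph_bracket xz').
(* If [m] is at least [N + N], then [k] or [m - k] is at least [N], and [C] vanishes. *)
rewrite /delta (@big_nat_support _ _ (N + N)) => [|m Nm].
  apply: eq_bigr => m _; rewrite (@fsum_seq _ _ degrees) => [|e es].
    rewrite (eq_bigr _ (fun e _ => delE m e)) exchange_big /=.
    by apply: eq_bigr => k _; exact: (sum_by_degree (fun d d' => C k d (m - k)%N d' x)).
  by rewrite delE big1 // => k _; exact: sum_degree_out.
rewrite fsbig1 // => e _; rewrite delE big1 // => k _; rewrite big1 // => d _.
rewrite big1 // => d' _; apply: delta_commutator_out.
case: (leqP N k) => //= kN; rewrite leq_subRL -1?ltnS //.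
by apply: leq_trans Nm; rewrite leq_add2r ltnW.
Qed.

Lemma delta_bracket_parts :
  delta A (derivation_bracket A D1 D2) =
  color_commutator eps V (delta A D1) (delta A D2).
Proof.
rewrite (color_commutator_parts gradV eps (delta_parts DF1 F10 wd1)
  (delta_parts DF2 F20 wd2)).
apply/funext => x; rewrite delta_derivation_bracket.
transitivity (\sum_(d <- undup s) \sum_(d' <- undup s)
    \sum_(k < N) \sum_(k' < N) C k d k' d' x).
  under eq_bigr => k _ do rewrite exchange_big /=.
  rewrite exchange_big /=; apply: eq_bigr => d _.
  under eq_bigr => k _ do rewrite exchange_big /=.
  by rewrite exchange_big.
apply: eq_bigr => d _; apply: eq_bigr => d' _.
(* The second composite sums over [k'] first; the order is exchanged to match the first composite
   term by term. *)
rewrite [X in _ - _ *: X](_ : _ =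
  \sum_(k < N) \sum_(k' < N) del2 k' d' (del1 k d x)); last first.
  rewrite exchange_big /=; apply: eq_bigr => k' _.
  exact: (linear_at_sum (@ldel2 _ _)).
rewrite scaler_sumr -sumrB; apply: eq_bigr => k _.
by rewrite [X in X - _](linear_at_sum (@ldel1 k d)) scaler_sumr -sumrB.
Qed.

End Homomorphism.

Theorem proposition5 (K : fieldType) (G : zmodType) (eps : G -> G -> K)
    (n : nat) (L : lmodType K) (A : nHomLieColor eps n L)
    (hn : (3 <= n)%N) (heps : skew_bicharacter eps)
    (hcenter : centerless A) (hperfect : perfect A) (hmult : multiplicative A)
    (D1 D2 : nat -> L -> L)
    (hD1 : all_double_derivations A D1) (hD2 : all_double_derivations A D2)
    (wd1 : delta_well_defined A D1) (wd2 : delta_well_defined A D2) :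
  delta A (derivation_bracket A D1 D2) =
  color_commutator eps (hcomp A) (delta A D1) (delta A D2).
Proof.
have [N1 [s1 [parts1 comm1 out1]]] := all_double_derivations_parts hD1.
have [N2 [s2 [parts2 comm2 out2]]] := all_double_derivations_parts hD2.
have sub1 : {subset s1 <= s1 ++ s2} by move=> d ds; rewrite mem_cat ds.
have sub2 : {subset s2 <= s1 ++ s2} by move=> d ds; rewrite mem_cat ds orbT.
apply: (@delta_bracket_parts _ _ _ _ _ A _ heps hperfect hmult
  (maxn N1 N2) (s1 ++ s2)) => //.
- by apply: leq_trans hn.
- by move=> k; exact: homogeneous_parts_widen sub1 (parts1 k).
- by move=> k; exact: homogeneous_parts_widen sub2 (parts2 k).
- by move=> k d x; rewrite geq_max => /andP[/out1].
- by move=> k d x; rewrite geq_max => /andP[_ /out2].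
Qed.
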